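(* Let $\mathcal{M}$ be a von Neumann algebra without central summands of type $I_1$, and let $\Phi:\mathcal{M}\to\mathcal{M}$ be a surjective map (not assumed additive or linear). Then $\Phi$ is strong skew commutativity preserving, that is, $\Phi(A)\Phi(B)-\Phi(B)\Phi(A)^*=AB-BA^*$ for all $A,B\in\mathcal{M}$, if and only if there exists an element $Z\in\mathcal{Z}_S(\mathcal{M})$ with $Z^2=I$ such that $\Phi(A)=ZA$ for all $A\in\mathcal{M}$.
   Context: A von Neumann algebra is a $*$-subalgebra $\mathcal{M}$ of $\mathcal{B}(H)$, the bounded linear operators on a complex Hilbert space $H$, that equals its double commutant: $\mathcal{M}''=\mathcal{M}$. $\mathcal{Z}(\mathcal{M})$ denotes the center of $\mathcal{M}$ and $\mathcal{Z}_S(\mathcal{M})=\{A\in\mathcal{Z}(\mathcal{M}):A=A^*\}$. *)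

(* Defs.v *)
From HB Require Import structures.
From mathcomp Require Import all_boot all_order all_algebra.
From mathcomp Require Import complex sesquilinear.
From mathcomp Require Import boolp classical_sets functions reals.
From mathcomp Require Import topology normedtype.

Set Implicit Arguments.
Unset Strict Implicit.
Unset Printing Implicit Defensive.

Import Order.TTheory GRing.Theory Num.Theory.
Import numFieldNormedType.Exports.

Local Open Scope classical_set_scope.
Local Open Scope ring_scope.
Local Open Scope complex_scope.

(* A complex Hilbert space over R[i]: the norm is the one given by the inner
   product, which is linear in its first argument and conjugate-linear in the
   second. The zero space is allowed. *)
HB.mixin Record CompleteNormedModule_isHilbert (R : realType) H
    of CompleteNormedModule R[i] H := {
  inner : {dot H for @Num.conj R[i]} ;
  inner_norm : forall x : H, inner x x = `|x| ^+ 2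
}.

#[short(type="hilbertType")]
HB.structure Definition Hilbert (R : realType) :=
  { H of CompleteNormedModule R[i] H & CompleteNormedModule_isHilbert R H }.

Section BoundedOperators.
Context {R : realType} (H : hilbertType R).

Definition bounded_linear (f : H -> H) : Prop :=
  linear f /\ exists c : R[i], forall x, `|f x| <= c * `|x|.

Definition bounded_linear_pred : {pred H -> H} := fun f => `[< bounded_linear f >].

Record boundedOp := BoundedOp {
  op_fun :> H -> H ;
  op_funP : op_fun \in bounded_linear_pred
}.

HB.instance Definition _ := [isSub for op_fun].
HB.instance Definition _ := [Choice of boundedOp by <:].

Lemma boundedOpP (A B : boundedOp) : (forall x, A x = B x) -> A = B.
Proof. by move=> AB; apply/val_inj/funext. Qed.

Lemma op_linear (A : boundedOp) : linear A.
Proof. by have /asboolP[] := op_funP A. Qed.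

Lemma op_bounded (A : boundedOp) : exists c : R[i], forall x, `|A x| <= c * `|x|.
Proof. by have /asboolP[] := op_funP A. Qed.

HB.instance Definition _ (A : boundedOp) :=
  GRing.isLinear.Build R[i] H H *:%R A (op_linear A).

Lemma op_bounded_ge0 (A : boundedOp) :
  exists2 c : R[i], 0 <= c & forall x, `|A x| <= c * `|x|.
Proof.
have [c Ac] := op_bounded A; exists `|c| => // x.
have [->|x0] := eqVneq x 0; first by rewrite linear0 !normr0 mulr0.
have c0 : 0 <= c.
  by rewrite -(pmulr_lge0 c (x := `|x|)) ?normr_gt0// (le_trans _ (Ac x)).
by rewrite ger0_norm.
Qed.

Lemma bounded_linear_submod : submod_closed bounded_linear_pred.
Proof.
split=> [|a f g /asboolP[fl [c fc]] /asboolP[gl [d gd]]]; apply/asboolP; split.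
- by move=> a x y; rewrite /= scaler0 addr0.
- by exists 0 => x; rewrite normr0 mul0r.
- move=> b x y; rewrite -[LHS]/(a *: f (b *: x + y) + g (b *: x + y)).
  rewrite -[RHS]/(b *: (a *: f x + g x) + (a *: f y + g y)).
  by rewrite fl gl !scalerDr !scalerA [a * b]mulrC addrACA.
- exists (`|a| * c + d) => x; rewrite -[X in `|X|]/(a *: f x + g x).
  rewrite mulrDl -mulrA (le_trans (ler_normD _ _))// lerD//.
  by rewrite normrZ ler_wpM2l.
Qed.

HB.instance Definition _ :=
  GRing.isSubmodClosed.Build R[i] (H -> H) bounded_linear_pred
    bounded_linear_submod.
HB.instance Definition _ := [SubChoice_isSubLmodule of boundedOp by <:].

Lemma bounded_linear_id : id \in bounded_linear_pred.
Proof. by apply/asboolP; split=> //; exists 1 => x; rewrite mul1r. Qed.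

Lemma bounded_linear_comp (A B : boundedOp) : A \o B \in bounded_linear_pred.
Proof.
apply/asboolP; split=> [a x y /=|]; first by rewrite !linearP.
have [c c0 Ac] := op_bounded_ge0 A; have [d d0 Bd] := op_bounded_ge0 B.
by exists (c * d) => x /=; rewrite (le_trans (Ac _))// -mulrA ler_wpM2l.
Qed.

Definition op_one := BoundedOp bounded_linear_id.
Definition op_mul (A B : boundedOp) := BoundedOp (bounded_linear_comp A B).

Lemma op_mulA : associative op_mul.
Proof. by move=> A B C; apply/boundedOpP. Qed.
Lemma op_mul1 : left_id op_one op_mul.
Proof. by move=> A; apply/boundedOpP. Qed.
Lemma op_mulr1 : right_id op_one op_mul.
Proof. by move=> A; apply/boundedOpP. Qed.
Lemma op_mulDl : left_distributive op_mul +%R.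
Proof. by move=> A B C; apply/boundedOpP. Qed.
Lemma op_mulDr : right_distributive op_mul +%R.
Proof. by move=> A B C; apply/boundedOpP => x /=; exact: linearD. Qed.

HB.instance Definition _ := GRing.Zmodule_isPzRing.Build boundedOp
  op_mulA op_mul1 op_mulr1 op_mulDl op_mulDr.

Lemma op_scalerAl (a : R[i]) (A B : boundedOp) : a *: (A * B) = (a *: A) * B.
Proof. by apply/boundedOpP. Qed.
Lemma op_scalerAr (a : R[i]) (A B : boundedOp) : a *: (A * B) = A * (a *: B).
Proof. by apply/boundedOpP => x; exact/esym/linearZ. Qed.

Lemma op0E x : (0 : boundedOp) x = 0. Proof. by []. Qed.
Lemma op1E x : (1 : boundedOp) x = x. Proof. by []. Qed.
Lemma opNE (A : boundedOp) x : (- A) x = - A x. Proof. by []. Qed.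
Lemma opDE (A B : boundedOp) x : (A + B) x = A x + B x. Proof. by []. Qed.
Lemma opME (A B : boundedOp) x : (A * B) x = A (B x). Proof. by []. Qed.
Lemma opZE a (A : boundedOp) x : (a *: A) x = a *: A x. Proof. by []. Qed.

End BoundedOperators.

Section VonNeumannAlgebras.
Context {R : realType} {H : hilbertType R}.
Local Notation "''B(H)'" := (boundedOp H).
Implicit Types (A B E F V P : 'B(H)) (M N : set 'B(H)).

(* The adjoint: the unique B with <A x, y> = <x, B y>. It exists by the Riesz
   representation theorem, so the default value 0 is never used. *)
Definition adj A : 'B(H) :=
  xget 0 [set B : 'B(H) | forall x y : H, inner (A x) y = inner x (B y)].

Definition commutant M : set 'B(H) := [set A | forall B, M B -> A * B = B * A].

Record star_subalgebra M : Prop := StarSubalgebra {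
  subalg0 : M 0 ;
  subalgP : forall (a : R[i]) A B, M A -> M B -> M (a *: A + B) ;
  subalgM : forall A B, M A -> M B -> M (A * B) ;
  subalg_adj : forall A, M A -> M (adj A)
}.

Definition von_neumann M : Prop :=
  star_subalgebra M /\ commutant (commutant M) = M.

Definition center M : set 'B(H) := M `&` commutant M.

Definition center_sa M : set 'B(H) := [set A | center M A /\ A = adj A].

Definition is_projection E : Prop := E * E = E /\ adj E = E.

Definition abelian_projection N E : Prop :=
  [/\ N E, is_projection E
    & forall A B, N A -> N B ->
        (E * A * E) * (E * B * E) = (E * B * E) * (E * A * E)].

Definition mvn_equiv N E F : Prop :=
  exists V, [/\ N V, adj V * V = E & V * adj V = F].

(* The algebra N, with unit P, is of type I_n: P is the sum of n mutually
   orthogonal and equivalent abelian projections. *)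
Definition type_I (n : nat) N P : Prop :=
  exists E : 'I_n -> 'B(H),
    [/\ forall i, abelian_projection N (E i),
        forall i j, i != j -> E i * E j = 0,
        forall i j, mvn_equiv N (E i) (E j)
      & \sum_(i < n) E i = P].

(* The summand MP cut out by a central projection P, viewed inside B(H); its
   unit is P. *)
Definition central_summand M P : set 'B(H) := [set A * P | A in M].

Definition no_central_summand_of_type_I (n : nat) M : Prop :=
  forall P, center M P -> is_projection P -> P != 0 ->
    ~ type_I n (central_summand M P) P.

End VonNeumannAlgebras.

(* Main.v *)
Require Import Defs.
From mathcomp Require Import all_boot all_order all_algebra.
From mathcomp Require Import boolp classical_sets functions reals.
From mathcomp Require Import complex sesquilinear normedtype.

(** The forward direction rests on complex linearity.  Write
    [A, B] = A B - B A^*.  It is complex linear in B, so for fixed A the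
    operator T = Phi (iA) - i Phi A satisfies [Phi C, T] = 0 for all C in M;
    since Phi is onto, X T = T X^* for all X in M, and X = i forces T = 0
    ([eq0_skew_commuting]).  Hence Phi (iA) = i Phi A.

    Put W = Phi 1.  Because the adjoint is conjugate linear, replacing A = 1 by
    A = i in the hypothesis turns the difference W Phi B - Phi B W^* into i
    times the corresponding sum.  The difference is 0 and the sum is 2 B, so
    W Phi B = B = Phi B W^* for every B in M.  Everything follows from these
    two equations: B = 1 gives W^2 = 1, hence Phi B = W B; then W W^* = 1 gives
    W^* = W; and W B W = B makes W central.

    Conversely, a central self-adjoint Z with square 1 cancels out of
    Z A Z B - Z B (Z A)^*.

    The adjoint is only ever moved across an invertible factor (a nonzero scalar
    or the involution Z).  Such a factor puts the adjoints of the two operators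
    in bijection, so the rules used for [adj] follow from the uniqueness of
    adjoints alone: either both operators have an adjoint, or both get the
    default value 0 of [adj]. *)

Set Implicit Arguments.
Unset Strict Implicit.
Unset Printing Implicit Defensive.

Import Order.TTheory GRing.Theory Num.Theory.
Local Open Scope classical_set_scope.
Local Open Scope ring_scope.

Section Adjoint.
Context {R : realType} {H : hilbertType R}.
Implicit Types (A B Z : boundedOp H) (a : R[i]).

Definition is_adjoint A B := forall x y : H, inner (A x) y = inner x (B y).

Lemma adjoint_unique A B1 B2 : is_adjoint A B1 -> is_adjoint A B2 -> B1 = B2.
Proof.
move=> AB1 AB2; apply: boundedOpP => y; apply/subr0_eq/eqP.
rewrite -normr_eq0 -sqrf_eq0 -inner_norm.
by rewrite linearBr /= -AB1 -AB2 subrr.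
Qed.

Lemma adj_eq A B : is_adjoint A B -> adj A = B.
Proof. by move=> AB; apply: xget_unique => // C hC; exact: adjoint_unique hC AB. Qed.

(** The rules for [adj] below are proved by cases on this alternative: an
    invertible factor transports adjoints both ways, so the second alternative
    holds for both operators or for neither. *)
Lemma adj_spec A :
  is_adjoint A (adj A) \/ (forall B, ~ is_adjoint A B) /\ adj A = 0.
Proof.
case: (pselect (exists B, is_adjoint A B)) => [[B AB]|nA].
  by left; rewrite (adj_eq AB).
right; split=> [B AB|]; first by apply: nA; exists B.
by apply: xgetPN => B AB; apply: nA; exists B.
Qed.

Lemma is_adjointZ a A B : is_adjoint A B -> is_adjoint (a *: A) (a^* *: B).
Proof. by move=> AB x y; rewrite !opZE linearZl_LR linearZr_LR /= conjCK AB. Qed.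

Lemma is_adjointM A A' B B' :
  is_adjoint A A' -> is_adjoint B B' -> is_adjoint (A * B) (B' * A').
Proof. by move=> AA' BB' x y; rewrite !opME AA' BB'. Qed.

Lemma adjZ a A : a != 0 -> adj (a *: A) = a^* *: adj A.
Proof.
move=> a0; case: (adj_spec A) => [/(is_adjointZ a)/adj_eq//|[nA ->]].
case: (adj_spec (a *: A)) => [/(is_adjointZ a^-1)|[_ ->]]; last by rewrite scaler0.
by rewrite scalerA mulVf// scale1r => /nA.
Qed.

Lemma adj1 : adj 1 = 1 :> boundedOp H.
Proof. exact: adj_eq. Qed.

(** If [adj Z] is the default value 0 then Z = 0, whose adjoint is 0. *)
Lemma is_adjoint_self Z : Z = adj Z -> is_adjoint Z Z.
Proof.
case: (adj_spec Z) => [ZZ eqZ|[_ ->] ->]; first by rewrite {2}eqZ.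
by move=> x y; rewrite !op0E linear0l linear0r.
Qed.

Lemma adj_involution_mul Z A : Z = adj Z -> Z * Z = 1 ->
  adj (Z * A) = adj A * Z.
Proof.
move=> /is_adjoint_self Zsa ZZ.
case: (adj_spec A) => [/(is_adjointM Zsa)/adj_eq//|[nA ->]].
case: (adj_spec (Z * A)) => [/(is_adjointM Zsa)|[_ ->]]; last by rewrite mul0r.
by rewrite mulrA ZZ mul1r => /nA.
Qed.

End Adjoint.

Section SkewCommutativity.
Context {R : realType} {H : hilbertType R}.
Implicit Types (A B T X Z : boundedOp H) (M : set (boundedOp H)).

Lemma von_neumann1 M : von_neumann M -> M 1.
Proof. by move=> [_ <-] B _; rewrite mul1r mulr1. Qed.

Lemma von_neumannZ M (a : R[i]) A : von_neumann M -> M A -> M (a *: A).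
Proof.
by move=> [sM _] MA; rewrite -[_ *: _]addr0; apply: subalgP => //; exact: subalg0.
Qed.

(** The scalar i already forces this: it gives i T = - i T. *)
Lemma eq0_skew_commuting M T : von_neumann M ->
  (forall X, M X -> X * T = T * adj X) -> T = 0.
Proof.
move=> vM /(_ ('i *: (1 : boundedOp H)) (von_neumannZ 'i vM (von_neumann1 vM))).
rewrite adjZ ?neq0Ci// adj1 conjCi -op_scalerAl -op_scalerAr mul1r mulr1 scaleNr.
move/eqP; rewrite -addr_eq0 -mulr2n -scaler_nat scalerA.
by rewrite scaler_eq0 mulf_eq0 pnatr_eq0 (negPf (neq0Ci _)) /= => /eqP.
Qed.

Lemma op_scalerI (a : R[i]) A B : a != 0 -> a *: A = a *: B -> A = B.
Proof.
by move=> a0 /(congr1 ( *:%R a^-1)); rewrite !scalerA mulVf// !scale1r.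
Qed.

Lemma op_double_inj A B : A + A = B + B -> A = B.
Proof.
have double C : C + C = 2%:R *: C :> boundedOp H by rewrite scaler_nat mulr2n.
by rewrite !double; apply: op_scalerI; rewrite pnatr_eq0.
Qed.

Definition skew_preserving M (Phi : boundedOp H -> boundedOp H) :=
  forall A B, M A -> M B ->
    Phi A * Phi B - Phi B * adj (Phi A) = A * B - B * adj A.

(** The skew commutator is linear in its second argument, so the defect
    Phi (iA) - i Phi A skew commutes with every Phi C, that is, with all of M. *)
Lemma skew_preservingZi M Phi A : von_neumann M -> set_surj M M Phi ->
  skew_preserving M Phi -> M A -> Phi ('i *: A) = 'i *: Phi A.
Proof.
move=> vnM onto skew MA; apply/subr0_eq/(eq0_skew_commuting vnM).
move=> _ /onto[C MC <-].
have eqA := skew C A MC MA.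
have := skew C ('i *: A) MC (von_neumannZ 'i vnM MA).
rewrite -op_scalerAr -op_scalerAl -scalerBr -eqA scalerBr op_scalerAr op_scalerAl.
move=> /eqP; rewrite subr_eq => /eqP eqiA.
by rewrite mulrBr mulrBl eqiA addrAC [_ - _ - _]addrAC subrr add0r addrC.
Qed.

(** The skew commutator of 1 with B gives the difference of the two products;
    that of i with B gives i times their sum, because the adjoint is conjugate
    linear. *)
Lemma skew_preserving_mul1 M Phi B : von_neumann M -> set_surj M M Phi ->
  skew_preserving M Phi -> M B ->
  Phi 1 * Phi B = B /\ Phi B * adj (Phi 1) = B.
Proof.
move=> vnM onto skew MB; have M1 := von_neumann1 vnM.
have diff0 : Phi 1 * Phi B - Phi B * adj (Phi 1) = 0.
  by rewrite skew// adj1 mulr1 mul1r subrr.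
have := skew _ _ (von_neumannZ 'i vnM M1) MB.
rewrite (skew_preservingZi vnM onto skew M1) !adjZ ?neq0Ci// adj1 conjCi.
rewrite -!op_scalerAl -!op_scalerAr mul1r mulr1 !scaleNr !opprK -!scalerDr.
move/(op_scalerI (neq0Ci _)); rewrite -(subr0_eq diff0).
by move/op_double_inj => ->.
Qed.

Lemma central_involution_skew_preserving M Phi Z : von_neumann M ->
  center_sa M Z -> Z ^+ 2 = 1 -> (forall A, M A -> Phi A = Z * A) ->
  skew_preserving M Phi.
Proof.
move=> [sM _] [[_ ZM] Zsa]; rewrite expr2 => ZZ PhiE A B MA MB.
rewrite !PhiE// adj_involution_mul//.
have comm C : M C -> Z * C = C * Z by exact: ZM.
rewrite -(comm _ (subalg_adj sM MA)).
by rewrite mulrA [Z * A]comm// [Z * B]comm// -!mulrA !(mulrA Z Z) ZZ !mul1r.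
Qed.

Lemma skew_preserving_central_involution M (Phi : boundedOp H -> boundedOp H) :
  von_neumann M -> (forall A, M A -> M (Phi A)) -> set_surj M M Phi ->
  skew_preserving M Phi ->
  exists Z, [/\ center_sa M Z, Z ^+ 2 = 1 & forall A, M A -> Phi A = Z * A].
Proof.
move=> vnM PhiM onto skew; have M1 := von_neumann1 vnM.
have mul1E B := @skew_preserving_mul1 M Phi B vnM onto skew.
have [WW WW'] := mul1E 1 M1.
have PhiE B : M B -> Phi B = Phi 1 * B.
  by move=> MB; rewrite -{2}(mul1E B MB).1 mulrA WW mul1r.
have Wsa : adj (Phi 1) = Phi 1.
  have : Phi 1 * Phi 1 * adj (Phi 1) = Phi 1 by rewrite -mulrA WW' mulr1.
  by rewrite WW mul1r.
exists (Phi 1); split=> //; split=> //; split; first exact: PhiM.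
move=> B MB; have [_ ] := mul1E B MB; rewrite PhiE// Wsa => WBW.
by rewrite -{2}WBW -!mulrA WW mulr1.
Qed.

End SkewCommutativity.

Theorem theorem3p1 (R : realType) (H : hilbertType R) (M : set (boundedOp H))
    (vnM : von_neumann M) (noI1 : no_central_summand_of_type_I 1 M)
    (Phi : {fun M >-> M}) (surjPhi : set_surj M M Phi) :
  (forall A B : boundedOp H, M A -> M B ->
     Phi A * Phi B - Phi B * adj (Phi A) = A * B - B * adj A)
  <->
  (exists Z : boundedOp H,
     [/\ center_sa M Z, Z ^+ 2 = 1
       & forall A : boundedOp H, M A -> Phi A = Z * A]).
Proof.
split=> [|[Z [Zsa ZZ PhiE]]].
  by apply: skew_preserving_central_involution => // A; exact: funS.
exact: central_involution_skew_preserving PhiE.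
Qed.
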